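(* Let $n\ge 2$, let $\Omega\subset\mathbb{R}^n$ be a bounded domain and let $0\le\gamma<3$. Let $u$ be a bounded, nonnegative viscosity solution to $\mathcal{L}^{\gamma}_\infty u=0$ in $\Omega$, and let $X_0\in\partial\{u>0\}\cap\Omega$. Then there exists a constant $C>0$, depending on $\|u\|_{L^\infty(\Omega)}$, $(3-\gamma)$ and $\mathrm{dist}(X_0,\partial\Omega)$, such that $$u(X)\le C\,|X-X_0|^{\frac{4}{3-\gamma}}$$ for all $X\in\{u>0\}$ near $X_0$ (i.e. in some neighborhood of $X_0$).
   Context: The infinity Laplacian is $\Delta_\infty u:=\sum_{i,j}\partial_i u\,\partial_{ij}u\,\partial_j u=(Du)^T D^2u\,Du$. Write $v^+=\max(v,0)$ and $\mathcal{L}^{\gamma}_\infty v:=\Delta_\infty v-(v^+)^\gamma$; for $\gamma=0$ the term $(v^+)^0$ is read as $1$ where $v>0$ and $0$ where $v\le 0$. A continuous function $u:\Omega\to\mathbb{R}$ is a viscosity subsolution of $\mathcal{L}^{\gamma}_\infty u=0$ in $\Omega$ (written $\mathcal{L}^\gamma_\infty u\ge 0$) if whenever $\varphi\in C^2$ and $u-\varphi$ has a local maximum at $Y\in\Omega$, then $\Delta_\infty\varphi(Y)-(u(Y)^+)^\gamma\ge 0$; it is a viscosity supersolution (written $\mathcal{L}^\gamma_\infty u\le 0$) if whenever $\varphi\in C^2$ and $\varphi-u$ has a local maximum at $Y\in\Omega$, then $\Delta_\infty\varphi(Y)-(u(Y)^+)^\gamma\le 0$. A viscosity solution is both. *)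

(* Defs.v *)
From HB Require Import structures.
From mathcomp Require Import all_boot all_order all_algebra.
From mathcomp Require Import all_classical all_reals all_analysis.
Set Implicit Arguments.
Unset Strict Implicit.
Unset Printing Implicit Defensive.
Import Order.TTheory GRing.Theory Num.Theory.
Import numFieldNormedType.Exports.
Local Open Scope classical_set_scope.
Local Open Scope ring_scope.

(* The library's norm [`|x|] on ['rV[R]_n] is the max norm.  It induces the
   usual topology of R^n, but lengths and distances have to be measured with
   the Euclidean norm. *)
Definition enorm (R : realType) (n : nat) (x : 'rV[R]_n) : R :=
  Num.sqrt (\sum_(i < n) x 0 i ^+ 2).

Definition boundary (T : topologicalType) (A : set T) : set T :=
  closure A `\` interior A.

Definition dist (R : realType) (n : nat) (x : 'rV[R]_n) (A : set 'rV[R]_n)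
  : R := inf [set enorm (x - y) | y in A].

Definition domain (R : realType) (n : nat) (Omega : set 'rV[R]_n) : Prop :=
  [/\ open Omega, connected Omega & Omega !=set0].

(* A function u : Omega -> R is represented by a total function on R^n of which
   only the values on Omega are ever used. *)

Definition positivity_set (R : realType) (n : nat) (Omega : set 'rV[R]_n)
  (u : 'rV[R]_n -> R) : set 'rV[R]_n := [set X | Omega X /\ 0 < u X].

(* The L^oo(Omega) norm, for u continuous and bounded on the open set Omega:
   nonempty open sets have positive Lebesgue measure, so the essential supremum
   of |u| is its supremum. *)
Definition Linfty_norm (R : realType) (n : nat) (Omega : set 'rV[R]_n)
  (u : 'rV[R]_n -> R) : R := sup [set `|u X| | X in Omega].

Definition partial (R : realType) (n : nat) (i : 'I_n) (f : 'rV[R]_n -> R)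
  : 'rV[R]_n -> R := fun x => 'D_(delta_mx 0 i) f x.

Definition C2_on (R : realType) (n : nat) (Omega : set 'rV[R]_n)
  (f : 'rV[R]_n -> R) : Prop :=
  forall x, Omega x ->
    {for x, continuous f} /\
    forall i : 'I_n,
      [/\ derivable f x (delta_mx 0 i),
          {for x, continuous (partial i f)} &
          forall j : 'I_n,
            derivable (partial i f) x (delta_mx 0 j) /\
            {for x, continuous (partial j (partial i f))}].

Definition infty_laplacian (R : realType) (n : nat) (f : 'rV[R]_n -> R)
  (x : 'rV[R]_n) : R :=
  \sum_(i < n) \sum_(j < n)
    partial i f x * partial i (partial j f) x * partial j f x.

(* (v^+)^gamma.  The case distinction matters for gamma = 0, where the value at
   v <= 0 has to be 0 whereas the library has [0 `^ 0 = 1]. *)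
Definition absorption (R : realType) (gamma v : R) : R :=
  if 0 < v then v `^ gamma else 0.

Definition has_local_max (R : realType) (n : nat) (f : 'rV[R]_n -> R)
  (Y : 'rV[R]_n) : Prop := \forall X \near Y, f X <= f Y.

Definition viscosity_subsolution (R : realType) (n : nat) (gamma : R)
  (Omega : set 'rV[R]_n) (u : 'rV[R]_n -> R) : Prop :=
  forall (phi : 'rV[R]_n -> R) (Y : 'rV[R]_n),
    C2_on Omega phi -> Omega Y ->
    has_local_max (fun X => u X - phi X) Y ->
    0 <= infty_laplacian phi Y - absorption gamma (u Y).

Definition viscosity_supersolution (R : realType) (n : nat) (gamma : R)
  (Omega : set 'rV[R]_n) (u : 'rV[R]_n -> R) : Prop :=
  forall (phi : 'rV[R]_n -> R) (Y : 'rV[R]_n),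
    C2_on Omega phi -> Omega Y ->
    has_local_max (fun X => phi X - u X) Y ->
    infty_laplacian phi Y - absorption gamma (u Y) <= 0.

Definition viscosity_solution (R : realType) (n : nat) (gamma : R)
  (Omega : set 'rV[R]_n) (u : 'rV[R]_n -> R) : Prop :=
  [/\ {in Omega, continuous u},
      viscosity_subsolution gamma Omega u &
      viscosity_supersolution gamma Omega u].

(* Main.v *)
(* Only the supersolution property and [u X0 = 0] matter.  Around a point [y]
   consider the convex radial profile [g s = b (rho - s) (3 rho - s)] in
   [s = |x - y|], which vanishes at [s = rho] and has [g 0 = A = 3 b rho^2].
   Its infinity Laplacian [g'^2 g''] is at least [8 b^3 rho^2], which exceeds
   [A^gamma] as soon as [A^(3 - gamma) > 27/8 rho^4].  If [u y > A], then [g - u]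
   cannot have a positive maximum over the ball: it would be attained off the
   centre and off the sphere, at a point [Y] with [u Y < g |Y - y| <= A],
   contradicting the supersolution inequality.  Hence [u > 0] in the ball.  With
   [rho = 2 |y - X0|] this is impossible, so
   [u y <= (64 |y - X0|^4)^(1/(3 - gamma))]. *)

Require Import Defs.
From HB Require Import structures.
From mathcomp Require Import all_boot all_order all_algebra.
From mathcomp Require Import all_classical all_reals all_analysis.
From mathcomp Require Import ring lra.
Import Order.TTheory GRing.Theory Num.Theory.
Import numFieldNormedType.Exports.
Local Open Scope classical_set_scope.
Local Open Scope ring_scope.

(** * Calculus of polynomials in the squared distance *)

Lemma is_derive_coord (R : realType) (n : nat) (i : 'I_n) (x v : 'rV[R]_n) :
  is_derive x v (fun z : 'rV[R]_n => z 0 i : R) (v 0 i).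
Proof.
have cvg_quot :
    (fun h => h^-1 *: (((h *: v + x) 0 i : R) - x 0 i)) @ 0^' --> v 0 i.
  apply: cvg_near_cst; near=> h; rewrite !mxE addrK scalerA mulVf ?scale1r//.
  by near: h; exact: nbhs_dnbhs_neq.
by apply: DeriveDef; [apply/cvg_ex; exists (v 0 i)|exact: cvg_lim].
Unshelve. all: by end_near. Qed.

(** Unlike the distance, its square is smooth at [y] too, so polynomials in it are test functions on
    all of [Omega]. *)
Definition sqdist {R : realType} {n : nat} (y x : 'rV[R]_n) : R :=
  \sum_(i < n) (x 0 i - y 0 i) ^+ 2.

Lemma is_derive_sqdist (R : realType) (n : nat) (y x : 'rV[R]_n) (i : 'I_n) :
  is_derive x (delta_mx 0 i) (sqdist y) (2 * (x 0 i - y 0 i)).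
Proof.
have -> : sqdist y = \sum_(k < n)
    ((fun z : 'rV[R]_n => z 0 k : R) - cst (y 0 k)) ^+ 2.
  by apply/funext => z; rewrite fct_sumE.
have dk (k : 'I_n) := is_derive_coord R n k x (delta_mx 0 i).
apply: is_derive_eq.
rewrite (bigD1 i)//= big1 ?addr0 => [|k kNi].
  by rewrite mxE !eqxx /= expr1 /GRing.scale/= !fctE; ring.
by rewrite mxE eqxx (negbTE kNi) subr0 /GRing.scale /= mulr0.
Qed.

Lemma is_derive_horner (R : realType) (n : nat) (p : {poly R})
    (f : 'rV[R]_n -> R) (x v : 'rV[R]_n) (df : R) :
  is_derive x v f df ->
  is_derive x v (fun z => p.[f z]) (p^`().[f x] * df).
Proof.
move=> fdf; elim/poly_ind: p => [|p c ihp].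
  rewrite (_ : (fun _ => _) = cst 0); last first.
    by apply/funext => z; rewrite horner0.
  by apply: is_derive_eq; rewrite deriv0 horner0 mul0r.
rewrite (_ : (fun _ => _) = (fun z => p.[f z]) * f + cst c); last first.
  by apply/funext => z; rewrite !hornerE.
apply: is_derive_eq.
by rewrite derivD derivM derivX derivC !hornerE/= /GRing.scale/=; ring.
Qed.

Lemma coordB_continuous (R : realType) (n : nat) (y : 'rV[R]_n) (i : 'I_n) :
  continuous (fun x : 'rV[R]_n => x 0 i - y 0 i : R).
Proof.
by move=> x; apply: continuousB;
  [apply: coord_continuous|apply: cst_continuous].
Qed.

Lemma sqdist_continuous (R : realType) (n : nat) (y : 'rV[R]_n) :
  continuous (sqdist y).
Proof.
apply: (@continuous_big R _ +%R 0) => [|i _ x]; first exact: add_continuous.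
have cont_i := @coordB_continuous R n y i x.
exact: (continuousM cont_i cont_i).
Qed.

Lemma radial_continuous (R : realType) (n : nat) (p : {poly R}) (y : 'rV[R]_n) :
  continuous (fun x => p.[sqdist y x]).
Proof.
by move=> x; apply: continuous_comp;
  [exact: sqdist_continuous|exact: continuous_horner].
Qed.

Lemma partial_radial (R : realType) (n : nat) (p : {poly R}) (y : 'rV[R]_n)
    (i : 'I_n) :
  partial i (fun x => p.[sqdist y x]) =
  (fun x => p^`().[sqdist y x]) * (fun x => 2 * (x 0 i - y 0 i)).
Proof.
apply/funext => x; rewrite /partial.
have := is_derive_sqdist R n y x i => /(is_derive_horner _ _ p) d.
by rewrite derive_val.
Qed.

Lemma is_derive_partial_radial (R : realType) (n : nat) (p : {poly R})
    (y : 'rV[R]_n) (i j : 'I_n) (x : 'rV[R]_n) :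
  is_derive x (delta_mx 0 j) (partial i (fun x => p.[sqdist y x]))
    (2 * (i == j)%:R * p^`().[sqdist y x] +
     4 * (x 0 i - y 0 i) * (x 0 j - y 0 j) * p^`()^`().[sqdist y x]).
Proof.
rewrite partial_radial.
have := is_derive_sqdist R n y x j => /(is_derive_horner _ _ p^`()) d.
have di := is_derive_coord R n i x (delta_mx 0 j).
rewrite (_ : (fun x => 2 * _) =
  cst 2 * ((fun z : 'rV[R]_n => z 0 i : R) - cst (y 0 i))); last exact/funext.
apply: is_derive_eq.
rewrite mxE eqxx /= /GRing.scale /= !fctE /=.
by ring.
Qed.

Lemma C2_radial (R : realType) (n : nat) (p : {poly R}) (y : 'rV[R]_n)
    (Omega : set 'rV[R]_n) : C2_on Omega (fun x => p.[sqdist y x]).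
Proof.
have cst_at (a : R) z : {for z, continuous (fun _ : 'rV[R]_n => a)}.
  exact: (@cst_continuous _ _ a z).
move=> x _; split; first exact: radial_continuous.
move=> i; split.
- have := is_derive_sqdist R n y x i => /(is_derive_horner _ _ p) d.
  exact: ex_derive.
- rewrite partial_radial.
  exact: continuousM (@radial_continuous R n p^`() y x)
    (continuousM (cst_at 2 x) (@coordB_continuous R n y i x)).
- move=> j; have d := is_derive_partial_radial R n p y i j; split.
    by have [] := d x.
  rewrite (_ : partial j _ = fun z =>
      2 * (i == j)%:R * p^`().[sqdist y z] +
      4 * (z 0 i - y 0 i) * (z 0 j - y 0 j) * p^`()^`().[sqdist y z]);
    last first.
    by apply/funext => z; rewrite /partial derive_val.
  apply: continuousD.
    exact: continuousM (cst_at _ x) (@radial_continuous R n p^`() y x).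
  exact: continuousM (continuousM (continuousM (cst_at 4 x)
    (@coordB_continuous R n y i x)) (@coordB_continuous R n y j x))
    (@radial_continuous R n p^`()^`() y x).
Qed.

(* With [g s := p.[s ^+ 2]] this is [g' s ^+ 2 * g'' s]. *)
Lemma infty_laplacian_radial (R : realType) (n : nat) (p : {poly R})
    (y x : 'rV[R]_n) (q := sqdist y x) :
  infty_laplacian (fun x => p.[sqdist y x]) x =
  8 * q * p^`().[q] ^+ 2 * (p^`().[q] + 2 * q * p^`()^`().[q]).
Proof.
pose z i := x 0 i - y 0 i.
rewrite /infty_laplacian.
(* The gradient is [2 p' z] and the Hessian is [2 p' I + 4 p'' z z^T], so each summand splits into a
   diagonal and a rank-one part. *)
have E (i j : 'I_n) : partial i (fun x => p.[sqdist y x]) x *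
   partial i (partial j (fun x => p.[sqdist y x])) x *
   partial j (fun x => p.[sqdist y x]) x =
   (j == i)%:R * (8 * p^`().[q] ^+ 3 * z i * z j) +
   16 * p^`().[q] ^+ 2 * p^`()^`().[q] * z i ^+ 2 * z j ^+ 2.
  have d := is_derive_partial_radial R n p y j i x.
  rewrite {2}/partial derive_val !partial_radial !fctE -/q -/(z i) -/(z j).
  by ring.
under eq_bigr => i _.
  under eq_bigr => j _ do rewrite E.
  rewrite big_split /= -mulr_sumr -/q (bigD1 i)//= big1 ?addr0; last first.
    by move=> j /negbTE ->; rewrite mul0r.
  rewrite eqxx mul1r -mulrA -expr2.
  over.
rewrite big_split /= -mulr_suml -!mulr_sumr -[\sum_(i < n) z i ^+ 2]/q.
by ring.
Qed.

(** * The Euclidean norm and its balls *)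

Lemma enormB (R : realType) (n : nat) (x y : 'rV[R]_n) :
  enorm (x - y) = Num.sqrt (sqdist y x).
Proof.
by rewrite /enorm /sqdist; congr Num.sqrt; apply: eq_bigr => i _; rewrite !mxE.
Qed.

Lemma sqdist_enorm (R : realType) (n : nat) (x y : 'rV[R]_n) :
  sqdist y x = enorm (x - y) ^+ 2.
Proof. by rewrite enormB sqr_sqrtr// sumr_ge0// => i _; exact: sqr_ge0. Qed.

Lemma enorm_ge0 (R : realType) (n : nat) (x : 'rV[R]_n) : 0 <= enorm x.
Proof. exact: sqrtr_ge0. Qed.

Lemma coord_le_enorm (R : realType) (n : nat) (x : 'rV[R]_n) (i : 'I_n) :
  `|x 0 i| <= enorm x.
Proof.
rewrite -sqrtr_sqr ler_wsqrtr// (bigD1 i)//= lerDl sumr_ge0// => j _.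
exact: sqr_ge0.
Qed.

Lemma enorm_eq0 (R : realType) (n : nat) (x : 'rV[R]_n) : enorm x = 0 -> x = 0.
Proof.
move=> x0; apply/rowP => i; rewrite mxE; apply/eqP.
by rewrite -normr_eq0 eq_le normr_ge0 andbT -x0 coord_le_enorm.
Qed.

Lemma enormN (R : realType) (n : nat) (x : 'rV[R]_n) : enorm (- x) = enorm x.
Proof.
by congr Num.sqrt; apply: eq_bigr => i _; rewrite mxE sqrrN.
Qed.

Lemma enorm_continuous (R : realType) (n : nat) (y : 'rV[R]_n) :
  continuous (fun x : 'rV[R]_n => enorm (x - y)).
Proof.
rewrite (_ : (fun _ => _) = Num.sqrt \o sqdist y); last first.
  by apply/funext => x; exact: enormB.
move=> x; apply: continuous_comp; first exact: sqdist_continuous.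
exact: sqrt_continuous.
Qed.

(** Closed by continuity, and contained in a product of compact segments because the Euclidean norm
    bounds each coordinate. *)
Lemma enorm_ball_compact (R : realType) (n : nat) (y : 'rV[R]_n) (rho : R) :
  compact [set x : 'rV[R]_n | enorm (x - y) <= rho].
Proof.
have box := @rV_compact R n (fun i => `[y 0 i - rho, y 0 i + rho]%classic)
  (fun i => @segment_compact _ _ _).
apply: subclosed_compact _ box _.
- apply: (@preimage_closed _ _ (fun x : 'rV[R]_n => enorm (x - y))
    [set r | r <= rho]).
    by move=> x _; exact: enorm_continuous.
  exact: closed_le.
- move=> x /= xy i; rewrite in_itv /= -ler_distl distrC.
  by have := le_trans (coord_le_enorm _ _ (x - y) i) xy; rewrite !mxE distrC.
Qed.

(** * The barrier and comparison on a ball *)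

(* The profile in [s = |x - y|] is not smooth at [s = 0], so it is no test
   function on all of Omega.  Replacing [s = sqrt q] by the cubic Taylor
   polynomial of [sqrt] at [s0 ^+ 2] gives a polynomial in [q] with the same 2-jet
   at [s0], which stays below the profile since the remainder is a multiple of
   [(s - s0)^4 (s^2 + 4 s s0 + 5 s0^2)]. *)
Lemma profile_test_polynomial (R : realType) (b rho s0 : R) :
  0 <= b -> 0 <= rho -> 0 < s0 -> exists p : {poly R},
  [/\ forall s, 0 <= s -> p.[s ^+ 2] <= b * (rho - s) * (3 * rho - s),
      p.[s0 ^+ 2] = b * (rho - s0) * (3 * rho - s0) &
      8 * s0 ^+ 2 * p^`().[s0 ^+ 2] ^+ 2 *
        (p^`().[s0 ^+ 2] + 2 * s0 ^+ 2 * p^`()^`().[s0 ^+ 2]) =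
      8 * b ^+ 3 * (2 * rho - s0) ^+ 2].
Proof.
move=> b0 rho0 s0gt0; have s0N0 : s0 != 0 by rewrite gt_eqF.
have [e eE] : {e : {poly R} | e = 'X - (s0 ^+ 2)%:P} by eexists.
(* As [b (rho - s) (3 rho - s) = 3 b rho^2 - 4 b rho s + b q] with [q = s^2], only the term linear
   in [s] has to be expanded in powers of [q - s0^2]. *)
pose c0 := b * (rho - s0) * (3 * rho - s0).
pose c1 := b - 2 * b * rho / s0.
pose c2 := b * rho / (2 * s0 ^+ 3).
pose c3 := - (b * rho / (4 * s0 ^+ 5)).
pose p := c0%:P + c1%:P * e + c2%:P * e ^+ 2 + c3%:P * e ^+ 3.
have pE t : p.[t] = c0 + c1 * (t - s0 ^+ 2) + c2 * (t - s0 ^+ 2) ^+ 2 +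
    c3 * (t - s0 ^+ 2) ^+ 3.
  by rewrite /p eE !(hornerXsubC, hornerD, hornerM, hornerC, horner_exp).
have de : e^`() = 1 by rewrite eE derivB derivX derivC subr0.
have dp : p^`() = c1%:P + (2 * c2)%:P * e + (3 * c3)%:P * e ^+ 2.
  rewrite /p !(derivD, derivM, derivC, deriv_exp) de !polyCM /=.
  by ring.
have ddp : p^`()^`() = (2 * c2)%:P + (6 * c3)%:P * e.
  rewrite dp !(derivD, derivM, derivC, deriv_exp) de !polyCM /=.
  by ring.
exists p; split.
- move=> s sge0; rewrite -subr_ge0.
  rewrite (_ : _ - _ = b * rho / (4 * s0 ^+ 5) *
      ((s - s0) ^+ 2) ^+ 2 * (s ^+ 2 + 4 * s * s0 + 5 * s0 ^+ 2)); last first.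
    by rewrite pE /c0 /c1 /c2 /c3; field.
  have s00 := ltW s0gt0.
  apply: mulr_ge0; first apply: mulr_ge0.
  + by rewrite divr_ge0 ?mulr_ge0 ?exprn_ge0.
  + exact: sqr_ge0.
  + by rewrite !addr_ge0 ?mulr_ge0 ?exprn_ge0.
- by rewrite pE /c0; ring.
(* At [s0^2], [p' = c1 = b (s0 - 2 rho) / s0] and [p' + 2 s0^2 p'' = b]. *)
- rewrite ddp dp !(hornerD, hornerM, hornerC, horner_exp).
  have -> : e.[s0 ^+ 2] = 0 by rewrite eE hornerXsubC subrr.
  by rewrite /c1 /c2; field.
Qed.

(** With [b = A / (3 rho^2)] the inequality between [rho] and [A] reads [A^gamma < 8 b^3 rho^2]: the
    infinity Laplacian of the barrier beats the absorption of every value up to [A]. *)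
Lemma supersolution_pos_ball (R : realType) (n : nat) (gamma : R)
    (Omega : set 'rV[R]_n) (u : 'rV[R]_n -> R) (y : 'rV[R]_n) (rho A : R) :
  0 <= gamma -> 0 < rho -> 0 < A ->
  27 * rho ^+ 4 * A `^ gamma < 8 * A ^+ 3 ->
  {in Omega, continuous u} -> viscosity_supersolution gamma Omega u ->
  (forall x, Omega x -> 0 <= u x) ->
  [set x | enorm (x - y) <= rho] `<=` Omega ->
  A < u y -> forall x, enorm (x - y) < rho -> 0 < u x.
Proof.
move=> gamma0 rho0 A0 Alt ucont usup u0 ballO Auy x xrho.
rewrite ltNge; apply/negP => ux.
pose b := A / (3 * rho ^+ 2).
have b0 : 0 < b by rewrite divr_gt0 ?mulr_gt0 ?exprn_gt0.
have bA : A = 3 * b * rho ^+ 2 by rewrite /b; field; rewrite gt_eqF.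
pose g s := b * (rho - s) * (3 * rho - s).
have g_gt0 s : s < rho -> 0 < g s.
  by move=> srho; apply: mulr_gt0; [apply: mulr_gt0 => //|]; lra.
have g_le s : 0 <= s <= rho -> g s <= A.
  move=> /andP[s0 srho]; rewrite bA /g -subr_ge0.
  rewrite (_ : _ - _ = b * s * (4 * rho - s)); last by ring.
  by apply: mulr_ge0; [apply: mulr_ge0 => //; exact: ltW|lra].
have fcont : {within [set z | enorm (z - y) <= rho],
    continuous (fun z => g (enorm (z - y)) - u z)}.
  apply: continuous_in_subspaceT => z; rewrite inE /= => zrho.
  pose p := b%:P * (rho%:P - 'X) * ((3 * rho)%:P - 'X).
  rewrite (_ : (fun _ => _) = (horner p \o fun z => enorm (z - y)) - u).
    apply: continuousB; last by apply: ucont; rewrite inE; exact: ballO.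
    apply: continuous_comp; first exact: enorm_continuous.
    exact: continuous_horner.
  by apply/funext => w; rewrite /p !fctE /= !hornerE.
have [|Y] := EVT_max_rV _ (enorm_ball_compact _ _ y rho) fcont.
  by exists x => /=; exact: ltW.
rewrite inE /= => Yrho Ymax.
set s0 := enorm (Y - y) in Yrho Ymax.
(* [g - u] is positive at [x], hence also at its maximum point. *)
have uYlt : u Y < g s0.
  rewrite -subr_gt0; apply: lt_le_trans (Ymax x _); last by rewrite inE /= ltW.
  by rewrite subr_gt0 (le_lt_trans ux)// g_gt0.
have uY0 : 0 <= u Y by apply/u0/ballO.
(* On the sphere [g] vanishes while [u] is nonnegative. *)
have s0rho : s0 < rho.
  rewrite lt_neqAle Yrho andbT; apply/eqP => s0rho.
  by move: uYlt; rewrite s0rho /g subrr mulr0 mul0r ltNge uY0.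
(* At the centre [g 0 <= A < u y]. This makes the expansion at [s0 > 0] available. *)
have s00 : 0 < s0.
  rewrite lt_neqAle enorm_ge0 andbT; apply/eqP => /esym s00.
  have Yy : Y = y by apply/eqP; rewrite -subr_eq0; apply/eqP/enorm_eq0.
  move: uYlt; rewrite s00 Yy ltNge => /negP; apply.
  by apply: le_trans (ltW Auy); apply: g_le; rewrite lexx ltW.
have [p [ple pY lapp]] :=
  profile_test_polynomial _ b rho s0 (ltW b0) (ltW rho0) s00.
have := usup (fun z => p.[sqdist y z]) Y (C2_radial _ _ _ _ _) (ballO _ Yrho).
rewrite infty_laplacian_radial sqdist_enorm -/s0 lapp.
have uYabs : absorption gamma (u Y) <= A `^ gamma.
  rewrite /absorption; case: ifPn => _; last exact: powR_ge0.
  rewrite ge0_ler_powR// ?nnegrE ?(ltW A0)// (le_trans (ltW uYlt))// g_le//.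
  by rewrite !ltW.
have lap_gt : A `^ gamma < 8 * b ^+ 3 * (2 * rho - s0) ^+ 2.
  have : A `^ gamma < 8 * b ^+ 3 * rho ^+ 2.
    rewrite -(ltr_pM2l (_ : 0 < 27 * rho ^+ 4)) ?mulr_gt0 ?exprn_gt0//.
    apply: (lt_le_trans Alt); rewrite bA le_eqVlt; apply/orP; left; apply/eqP.
    by ring.
  move=> /lt_le_trans; apply.
  have rho_le : rho ^+ 2 <= (2 * rho - s0) ^+ 2.
    by apply: lerXn2r; rewrite ?nnegrE; lra.
  by apply: ler_wpM2l rho_le; rewrite mulr_ge0// exprn_ge0// ltW.
move=> H; suff : 8 * b ^+ 3 * (2 * rho - s0) ^+ 2 - absorption gamma (u Y) <= 0.
  by move: lap_gt uYabs; lra.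
(* In the open ball [p <= g], with equality at [Y], so the maximum of [g - u] passes to [p - u]. *)
apply: H; have : \forall X \near Y, enorm (X - y) < rho.
  exact: (@cvgr_lt _ _ _ _ _ s0 (@enorm_continuous R n y Y)).
apply: filterS => X Xrho.
have Xmax := Ymax X; rewrite inE /= in Xmax; have {}Xmax := Xmax (ltW Xrho).
rewrite !sqdist_enorm -/s0 pY; apply: le_trans Xmax.
by rewrite lerB// ple// enorm_ge0.
Qed.

(** * Growth at a free boundary point *)

Theorem theorem4p2 (R : realType) (gamma M d : R) :
  0 <= gamma -> gamma < 3 ->
  exists C : R, 0 < C /\
    forall (n : nat) (Omega : set 'rV[R]_n) (u : 'rV[R]_n -> R)
           (X0 : 'rV[R]_n),
      (2 <= n)%N ->
      domain Omega -> bounded_set Omega ->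
      viscosity_solution gamma Omega u ->
      [bounded u X | X in Omega] ->
      (forall X, Omega X -> 0 <= u X) ->
      boundary (positivity_set Omega u) X0 -> Omega X0 ->
      Linfty_norm Omega u = M ->
      dist X0 (boundary Omega) = d ->
      \forall X \near X0, positivity_set Omega u X ->
        u X <= C * enorm (X - X0) `^ (4 / (3 - gamma)).
Proof.
move=> gamma0 gamma3; have k0 : 0 < 3 - gamma by rewrite subr_gt0.
(* With this [C], [A = C r^(4 / (3 - gamma))] satisfies [A^(3 - gamma) = 64 r^4], above the
   threshold [27/8 (2 r)^4 = 54 r^4] for the radius [2 r]. *)
exists (64 `^ (3 - gamma)^-1); split; first exact: powR_gt0.
move=> n Omega u X0 _ [Oopen _ _] _ [ucont _ usup] _ u0 [_ X0int] OX0 _ _.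
(* Otherwise continuity would make [X0] interior to the positivity set. *)
have uX0 : ~ 0 < u X0.
  move=> uX0; apply: X0int.
  have uX0cont : {for X0, continuous u} by apply: ucont; rewrite inE.
  have OX0nbhs : nbhs X0 Omega by exact: open_nbhs_nbhs.
  exact: filterS2 (fun x Ox ux => conj Ox ux) OX0nbhs (cvgr_gt _ uX0cont _ uX0).
have [e /= e0 ballO] : nbhs_ball X0 Omega.
  by apply/nbhs_ballP; exact: open_nbhs_nbhs.
(* The ball of radius [2 r] about [X] stays within [3 r < e] of [X0], hence inside [Omega]. *)
have : \forall X \near X0, enorm (X - X0) < e / 3.
  apply: (@cvgr_lt _ _ _ _ _ (enorm (X0 - X0)) (@enorm_continuous R n X0 X0)).
  rewrite enormB (_ : sqdist X0 X0 = 0) ?sqrtr0 ?divr_gt0//.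
  by apply: big1 => i _; rewrite subrr expr0n.
apply: filterS => X Xe [OX uX]; set r := enorm (X - X0) in Xe *.
have r0 : 0 < r.
  rewrite lt_neqAle enorm_ge0 andbT; apply/eqP => /esym /enorm_eq0 XX0.
  by apply: uX0; move/eqP: XX0; rewrite subr_eq0 => /eqP <-.
rewrite leNgt; apply/negP; set A := _ * _ => AuX.
have A0 : 0 < A by rewrite mulr_gt0 ?powR_gt0.
have AE : A `^ (3 - gamma) = 64 * r ^+ 4.
  rewrite powRM ?powR_ge0// -!powRrM mulVf ?gt_eqF// divfK ?gt_eqF//.
  by rewrite powRr1// powR_mulrn// ltW.
have A3 : A ^+ 3 = 64 * r ^+ 4 * A `^ gamma.
  rewrite -AE -powRD; last by rewrite (gt_eqF A0) implybT.
  by rewrite subrK -powR_mulrn// ltW.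
(* [X0] lies at distance [r < 2 r] from [X], so positivity on the ball about [X] would give
   [0 < u X0]. *)
apply: uX0.
apply: (@supersolution_pos_ball R n gamma Omega u X (2 * r) A) => //.
- by rewrite mulr_gt0.
- rewrite A3 -subr_gt0.
  rewrite (_ : _ - _ = 80 * r ^+ 4 * A `^ gamma); last by ring.
  by rewrite !mulr_gt0 ?exprn_gt0 ?powR_gt0.
(* [ball] is taken in the max norm, so the distances are compared coordinatewise. *)
- move=> x /= xX; apply: ballO; split => // i j; rewrite (ord1 i).
  have := coord_le_enorm _ _ (x - X) j; have := coord_le_enorm _ _ (X - X0) j.
  rewrite !mxE -/r => Xj xj; rewrite /ball /= distrC.
  rewrite -(subrKA (X 0 j)) (le_lt_trans (ler_normD _ _))//.
  by move: xX Xe Xj xj; lra.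
- by rewrite -enormN opprB -/r; lra.
Qed.
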